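(* It holds that \[\mathcal{S}^{rev}_c=\left\{S\in \mathcal{S}^0_c : M_0<\infty,\ I_0>-\infty,\ \limsup_{x\to\infty}S_x=M_\infty,\ \liminf_{x\to-\infty}S_x=I_{-\infty}\right\},\] where the limits $M_\infty =\lim_{x\to\infty}M_x=\sup_{x \in\mathbb{R}}S_x$ and $I_{-\infty}=\lim_{x\to-\infty}I_x=\inf_{x\in\mathbb{R}}S_x$ are well-defined by monotonicity.
   Context: Let $\mathcal{S}^0_c=\{S:\mathbb{R}\to\mathbb{R} : S_0=0,\ S\text{ continuous}\}$. For $S\in\mathcal{S}_c^0$ let $M_x=\sup_{y\le x}S_y$ and $I_x=\inf_{y\ge x}S_y$ (extended real valued). $TS$ is well-defined iff $\limsup_{x\to-\infty}S_x<\infty$, and then $(TS)_x=2M_x-S_x-2M_0$; $T^{-1}S$ is well-defined iff $\liminf_{x\to\infty}S_x>-\infty$, and then $(T^{-1}S)_x=2I_x-S_x-2I_0$ (here $T^{-1}$ is just the name of this map). Define \[\mathcal{S}^{rev}_c=\left\{S \in \mathcal{S}_c^0 : TS,\ T^{-1}S,\ T^{-1}TS,\ TT^{-1}S\text{ well-defined},\ T^{-1}TS=S,\ TT^{-1}S=S \right\}.\] *)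

(* Defs.v *)
From HB Require Import structures.
From mathcomp Require Import all_boot all_order all_algebra.
From mathcomp Require Import all_classical all_reals all_analysis.
Set Implicit Arguments.
Unset Strict Implicit.
Unset Printing Implicit Defensive.
Import Order.TTheory GRing.Theory Num.Theory.
Import numFieldNormedType.Exports.
Local Open Scope classical_set_scope.
Local Open Scope ring_scope.

Section PitmanTransform.
Context {R : realType}.
Implicit Type S : R -> R.

Definition Sc0 : set (R -> R) := [set S | S 0 = 0 /\ continuous S].

Definition pastsup S (x : R) : \bar R :=
  ereal_sup [set (S y)%:E | y in [set y | y <= x]].

Definition futureinf S (x : R) : \bar R :=
  ereal_inf [set (S y)%:E | y in [set y | x <= y]].

Definition pastsup_oo S : \bar R := lim (pastsup S x @[x --> +oo]).

Definition futureinf_Noo S : \bar R := lim (futureinf S x @[x --> -oo]).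

Definition limsup_oo S : \bar R := limf_esup (EFin \o S) +oo.

Definition limsup_Noo S : \bar R := limf_esup (EFin \o S) -oo.

Definition liminf_oo S : \bar R := limf_einf (EFin \o S) +oo.

Definition liminf_Noo S : \bar R := limf_einf (EFin \o S) -oo.

(* The transforms are partial maps: [PT] and [PTinv] are total functions whose
   values are meaningful only under [PT_defined] and [PTinv_defined], since
   [fine] sends infinite values to 0. For continuous S these conditions make
   [pastsup S x], resp. [futureinf S x], finite for every x. *)
Definition PT_defined S : Prop := (limsup_Noo S < +oo)%E.

Definition PT S : R -> R :=
  fun x => 2 * fine (pastsup S x) - S x - 2 * fine (pastsup S 0).

Definition PTinv_defined S : Prop := (-oo < liminf_oo S)%E.

(* Despite its name, not defined as an inverse of [PT]. *)
Definition PTinv S : R -> R :=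
  fun x => 2 * fine (futureinf S x) - S x - 2 * fine (futureinf S 0).

Definition Screv : set (R -> R) :=
  [set S | Sc0 S /\
    [/\ PT_defined S, PTinv_defined S,
        PTinv_defined (PT S) & PT_defined (PTinv S)] /\
    PTinv (PT S) = S /\ PT (PTinv S) = S].

End PitmanTransform.

(* Main.v *)
(* Since M is nondecreasing, 2 M_y - S_y >= M_y >= M_x for y >= x, so the
   future infimum of TS at x is at least M_x - 2 M_0. By continuity equality
   holds for every x as soon as S keeps returning close to its past supremum,
   which is what limsup_{x -> oo} S = M_oo says; then T^-1 T S = S follows by
   cancellation. Conversely T^-1 T S = S forces the future infimum of TS to be
   M_x - 2 M_0 + d with d constant; evaluating TS at x itself gives
   S_x <= M_x - d for all x, hence d <= 0, which gives back the recurrence.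
   The half turn S |-> (x |-> - S (- x)) conjugates T with T^-1, which reduces
   everything about T T^-1 to T^-1 T. *)
Require Import Defs.
From HB Require Import structures.
From mathcomp Require Import all_boot all_order all_algebra.
From mathcomp Require Import all_classical all_reals all_analysis.
From mathcomp Require Import lra.
Set Implicit Arguments.
Unset Strict Implicit.
Unset Printing Implicit Defensive.
Import Order.TTheory GRing.Theory Num.Theory.
Import numFieldNormedType.Exports.
Local Open Scope classical_set_scope.
Local Open Scope ring_scope.

Section PitmanTransformTheory.
Context {R : realType}.
Implicit Types (S : R -> R) (x y z c e : R).

(** * Past supremum: monotonicity, limit at infinity, finiteness *)

Lemma pastsup_ge S x y : y <= x -> ((S y)%:E <= pastsup S x)%E.
Proof. by move=> yx; apply: ereal_sup_ubound; exists y. Qed.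

Lemma pastsup_le S x (c : \bar R) :
  (forall y, y <= x -> ((S y)%:E <= c)%E) -> (pastsup S x <= c)%E.
Proof. by move=> Sc; apply: ge_ereal_sup => _ [y /= yx <-]; exact: Sc. Qed.

Lemma pastsup_nd S x y : x <= y -> (pastsup S x <= pastsup S y)%E.
Proof.
by move=> xy; apply: pastsup_le => z zx; apply/pastsup_ge/(le_trans zx).
Qed.

Lemma ereal_sup_pastsup S :
  ereal_sup (range (pastsup S)) = ereal_sup (range (EFin \o S)).
Proof.
apply/eqP; rewrite eq_le; apply/andP; split; apply: ge_ereal_sup.
  move=> _ [x _ <-]; apply: pastsup_le => y _.
  by apply: ereal_sup_ubound; exists y.
move=> _ [x _ <-]; apply: le_ereal_sup_tmp; exists (pastsup S x).
  by exists x.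
exact: pastsup_ge.
Qed.

Lemma pastsup_cvg S :
  pastsup S x @[x --> +oo] --> ereal_sup (range (EFin \o S)).
Proof.
rewrite -ereal_sup_pastsup; apply: nondecreasing_cvge => x y.
exact: pastsup_nd.
Qed.

Lemma pastsup_ooE S : pastsup_oo S = ereal_sup (range (EFin \o S)).
Proof. by apply/cvg_lim => //; exact: pastsup_cvg. Qed.

Lemma continuous_bounded_segment S a b : continuous S ->
  exists c, forall y, a <= y <= b -> S y <= c.
Proof.
move=> Sc; have [ab|ba] := leP a b; last first.
  by exists 0 => y /andP[ay yb]; have := le_lt_trans (le_trans ay yb) ba;
    rewrite ltxx.
have [|c _ cmax] := @EVT_max R S a b ab.
  by apply: continuous_subspaceT => x; exact: Sc.
by exists (S c) => y yab; apply: cmax; rewrite in_itv.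
Qed.

(** Beyond [a], the past of [x] only adds a compact segment, on which the continuous [S] is
    bounded. *)
Lemma pastsup_lty S a x : continuous S ->
  (pastsup S a < +oo)%E -> (pastsup S x < +oo)%E.
Proof.
move=> Sc Sa; have [c Sxc] := continuous_bounded_segment a x Sc.
apply: (@le_lt_trans _ _ (maxe (pastsup S a) c%:E)).
  apply: pastsup_le => y yx; rewrite le_max; have [ya|ay] := leP y a.
    by rewrite pastsup_ge.
  by rewrite lee_fin Sxc ?orbT// (ltW ay).
by rewrite gt_max Sa ltry.
Qed.

Section bounded_past.
Variable S : R -> R.
Hypotheses (Sc : continuous S) (S0y : (pastsup S 0 < +oo)%E).

Local Notation M x := (fine (pastsup S x)).

(** [S x] rules out the value -oo and [pastsup_lty] rules out +oo. From here on M can be handled by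
    real arithmetic. *)
Lemma pastsup_fineK x : (M x)%:E = pastsup S x.
Proof.
rewrite fineK// fin_real// (pastsup_lty _ Sc S0y) andbT.
by apply: lt_le_trans (pastsup_ge _ (lexx x)); rewrite ltNyr.
Qed.

Lemma le_fine_pastsup x y : y <= x -> S y <= M x.
Proof. by move=> yx; rewrite -lee_fin pastsup_fineK; exact: pastsup_ge. Qed.

Lemma fine_pastsup_le x c : (forall y, y <= x -> S y <= c) -> M x <= c.
Proof.
by move=> Sxc; rewrite -lee_fin pastsup_fineK; apply: pastsup_le => y /Sxc.
Qed.

Lemma fine_pastsup_nd x y : x <= y -> M x <= M y.
Proof. by move=> xy; rewrite -lee_fin !pastsup_fineK; exact: pastsup_nd. Qed.

End bounded_past.

(** * Hitting times and the future infimum *)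

Lemma futureinf_fin f x c : (forall y, x <= y -> c <= f y) ->
  futureinf f x \is a fin_num.
Proof.
move=> cf; rewrite fin_real//; apply/andP; split.
  apply: (@lt_le_trans _ _ c%:E); first exact: ltNyr.
  by apply: le_ereal_inf_tmp => _ [y /= xy <-]; rewrite lee_fin cf.
apply: (@le_lt_trans _ _ (f x)%:E); last exact: ltry.
by apply: ereal_inf_lbound; exists x => /=.
Qed.

(** Stopping at the first visit to level [c] keeps the path below [c] until then. With [c] the past
    supremum at [x], this keeps M constant between [x] and [z]. *)
Lemma first_hitting S x y c : continuous S -> x <= y -> S x <= c <= S y ->
  exists z, [/\ x <= z, S z = c & forall w, x <= w <= z -> S w <= c].
Proof.
move=> Sc xy /andP[Sxc cSy].
pose A : set R := [set z | x <= z /\ c <= S z].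
have Ax : lbound A x by move=> z [].
have infA : has_inf A by split; [exists y|exists x].
set z := inf A; have xz : x <= z by apply: lb_le_inf => //; exists y.
have before w : x <= w -> w < z -> S w < c.
  move=> xw; rewrite ltNge => /negP wz; rewrite ltNge; apply/negP => cSw.
  by apply: wz; apply: ge_inf => //; exists x.
(* If S z > c, the intermediate value theorem gives a visit to [c] in [x, z]: one before [z]
   contradicts [before], and one at [z] contradicts S z > c. *)
have Szc : S z <= c.
  move: xz; rewrite le_eqVlt => /predU1P[<-//|xz].
  rewrite leNgt; apply/negP => cltSz.
  have [||v /itvP vxz Svc] := @IVT R S x z c (ltW xz).
    by apply: continuous_subspaceT => t; exact: Sc.
    by rewrite ge_min le_max Sxc/= (ltW cltSz) orbT.
  have := before v; rewrite vxz Svc ltxx => /(_ isT) vz.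
  have [zv|/vz//] := leP z v.
  have vE : v = z by apply/eqP; rewrite eq_le zv vxz.
  by move: cltSz; rewrite -vE Svc ltxx.
(* If S z < c, continuity keeps S below [c] near [z], yet the infimum [z] has points of [A]
   arbitrarily close on its right. *)
have cSz : c <= S z.
  rewrite leNgt; apply/negP => Szlt.
  have /nbhs_ballP[d /= d0 dS] : \forall w \near z, S w < c.
    exact: (cvgr_lt _ (Sc z)).
  have [w [xw cSw] wzd] := inf_adherent d0 infA.
  have zw : z <= w by apply: ge_inf => //; exists x.
  suff : S w < c by rewrite ltNge cSw.
  apply: dS; rewrite /ball/= ler0_norm ?subr_le0//; rewrite -/z in wzd; lra.
exists z; split=> //; first by apply/eqP; rewrite eq_le Szc.
by move=> w /andP[xw]; rewrite le_eqVlt => /predU1P[->//|wz]; apply/ltW/before.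
Qed.

Lemma futureinf_le f x y : x <= y -> (futureinf f x <= (f y)%:E)%E.
Proof. by move=> xy; apply: ereal_inf_lbound; exists y. Qed.

Lemma futureinf_ge f x (c : \bar R) :
  (forall y, x <= y -> (c <= (f y)%:E)%E) -> (c <= futureinf f x)%E.
Proof. by move=> cf; apply: le_ereal_inf_tmp => _ [y /= xy <-]; exact: cf. Qed.

Lemma futureinf_eq f x c : (forall y, x <= y -> c <= f y) ->
  (forall e, 0 < e -> exists2 y, x <= y & f y < c + e) ->
  futureinf f x = c%:E.
Proof.
move=> cf fc; apply/eqP; rewrite eq_le; apply/andP; split.
  apply/lee_addgt0Pr => e /fc[y xy fy].
  by apply: le_trans (futureinf_le f xy) _; rewrite -EFinD lee_fin ltW.
by apply: futureinf_ge => y xy; rewrite lee_fin cf.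
Qed.

(** * Recurrence to the past supremum, and inverting T *)

Section recurrence.
Variable S : R -> R.
Hypotheses (Sc : continuous S) (S0y : (pastsup S 0 < +oo)%E).

Local Notation M x := (fine (pastsup S x)).

(** An epsilon form of limsup S = M_oo that compares with the finite values M_x, so it also covers
    M_oo = +oo. *)
Definition recurrent :=
  forall x e, 0 < e -> exists2 y, x <= y & M x - e < S y.

Lemma limsup_oo_recurrent : limsup_oo S = pastsup_oo S <-> recurrent.
Proof.
rewrite pastsup_ooE; split => [limE x e e0|rec].
  (* Without a return, S stays at most M_x - e after [x], so its limsup is strictly below M_x and
     hence below sup S. *)
  apply: contrapT => noy.
  have : ((M x)%:E <= (M x - e)%:E)%E.
    rewrite {1}(pastsup_fineK Sc S0y).
    apply: (@le_trans _ _ (ereal_sup (range (EFin \o S)))).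
      by apply: pastsup_le => y _; apply: ereal_sup_ubound; exists y.
    rewrite -limE; apply: ereal_inf_le.
    exists (ereal_sup ((EFin \o S) @` [set y | x < y])).
      by exists [set y | x < y] => //; exists x; split; first exact: num_real.
    apply: ge_ereal_sup => _ [y /= xy <-]; rewrite lee_fin leNgt.
    by apply/negP => ySe; apply: noy; exists y => //; exact: ltW.
  by rewrite lee_fin; lra.
apply/eqP; rewrite eq_le; apply/andP; split.
  apply: ereal_inf_le; exists (ereal_sup ((EFin \o S) @` setT)) => //.
  by exists setT => //; exact: filterT.
rewrite -ereal_sup_pastsup; apply: ge_ereal_sup => _ [x _ <-].
apply: le_ereal_inf_tmp => _ [V [N [_ NV]] <-]; rewrite -(pastsup_fineK Sc S0y).
apply/lee_addgt0Pr => e e0.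
(* [V] contains the open half-line beyond [N]; the shift to N + 1 puts [y] strictly inside it. *)
have [y xNy ySe] := rec (Num.max x (N + 1)) e e0.
have [xy Ny] : x <= y /\ N + 1 <= y by move: xNy; rewrite ge_max => /andP.
apply: (@le_trans _ _ ((S y)%:E + e%:E)%E).
  rewrite -EFinD lee_fin -lerBlDr (le_trans _ (ltW ySe))// lerD2r.
  by rewrite fine_pastsup_nd// le_max lexx.
rewrite leeD2r//; apply: ereal_sup_ubound; exists y => //.
by apply: NV; rewrite (lt_le_trans _ Ny)// ltrDl.
Qed.

Lemma PT_ge x y : x <= y -> M x - 2 * M 0 <= PT S y.
Proof.
move=> xy; have := fine_pastsup_nd Sc S0y xy.
by have := le_fine_pastsup Sc S0y (lexx y); rewrite /PT; lra.
Qed.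

Lemma futureinf_PT x : recurrent -> futureinf (PT S) x = (M x - 2 * M 0)%:E.
Proof.
move=> rec; apply: futureinf_eq => [y|e e0]; first exact: PT_ge.
(* The value is approached at a time when S is within [e] of M_x and M has not yet grown beyond M_x.
   If S reaches M_x after [x], the first hitting time serves; otherwise M never grows after [x], and
   recurrence supplies the time. *)
have [[w [xw Mw]]|noexit] := pselect (exists w, x <= w /\ M x <= S w).
  have [|z [xz Sz zmax]] := first_hitting (c := M x) Sc xw.
    by rewrite le_fine_pastsup.
  exists z => //; suff : M z <= M x by rewrite /PT; lra.
  apply: fine_pastsup_le => // u uz; have [ux|/ltW xu] := leP u x.
    exact: le_fine_pastsup.
  by rewrite zmax ?xu.
have [y xy Sy] := rec x e e0.
exists y => //; suff : M y <= M x by rewrite /PT; lra.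
apply: fine_pastsup_le => // u uy; have [ux|/ltW xu] := leP u x.
  exact: le_fine_pastsup.
by rewrite leNgt; apply/negP => /ltW Mu; apply: noexit; exists u.
Qed.

Lemma PTK_recurrent : PTinv (PT S) = S <-> recurrent.
Proof.
split => [PTK x e e0|rec]; last first.
  by apply/funext => x; rewrite /PTinv !futureinf_PT//= /PT; lra.
pose J y := fine (futureinf (PT S) y).
have JK y : (J y)%:E = futureinf (PT S) y.
  by rewrite fineK//; apply: (@futureinf_fin _ _ (M y - 2 * M 0)) => z /PT_ge.
have PTJ y : J y <= PT S y by rewrite -lee_fin JK futureinf_le.
have SJ y : S y = 2 * J y - PT S y - 2 * J 0 by rewrite -[in LHS]PTK.
(* Solving [SJ] for J gives J y = M y - 2 M 0 + d. *)
pose d := J 0 + M 0.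
have Sd y : S y <= M y - d.
  by have := PTJ y; have := SJ y; rewrite /d /PT; lra.
have d0 : d <= 0.
  suff : M x <= M x - d by lra.
  apply: fine_pastsup_le => // y yx; apply: le_trans (Sd y) _.
  by rewrite lerD2r fine_pastsup_nd.
(* At a near-minimizer [y] of T S after [x], 2 M y - S y < M x + d + e; with M x <= M y and d <= 0
   this yields S y > M x - e. *)
have [_ [y /= xy <-]] := lb_ereal_inf_adherent e0 (futureinf_fin (@PT_ge x)).
rewrite -/(futureinf _ _) -JK -EFinD lte_fin => Jy; exists y => //.
have := fine_pastsup_nd Sc S0y xy; have := SJ x.
by move: Jy d0; rewrite /d /PT; lra.
Qed.

(** By [PT_ge], T S is bounded below by - M 0 on the positive half-line. *)
Lemma PTinv_defined_PT : PTinv_defined (PT S).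
Proof.
rewrite /PTinv_defined /liminf_oo limf_einfE.
apply: (@lt_le_trans _ _ (M 0 - 2 * M 0)%:E); first exact: ltNyr.
apply: le_ereal_sup_tmp.
exists (ereal_inf ((EFin \o PT S) @` [set x | 0 < x])).
  by exists [set x | 0 < x] => //; exists 0; split; first exact: num_real.
apply: le_ereal_inf_tmp => _ [y /= y0 <-].
by rewrite lee_fin PT_ge// ltW.
Qed.

End recurrence.

Lemma PT_definedE S : continuous S ->
  PT_defined S <-> (pastsup S 0 < +oo)%E.
Proof.
move=> Sc; split=> [|S0y].
  move=> /ereal_inf_lt[_ [V [N [_ NV]] <-]] Vy.
  (* The bound holds on [V], which contains the open half-line before [N]; the closed past of N - 1
     lies inside it. *)
  apply: (@pastsup_lty _ (N - 1)) => //; apply: le_lt_trans Vy.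
  apply: pastsup_le => y yN; apply: ereal_sup_ubound; exists y => //.
  by apply: NV; rewrite (le_lt_trans yN)// ltrBlDr ltrDl.
apply: le_lt_trans S0y; apply: ereal_inf_le.
exists (ereal_sup ((EFin \o S) @` [set y | y < 0])).
  by exists [set y | y < 0] => //; exists 0; split; first exact: num_real.
by apply: ge_ereal_sup => _ [y /= y0 <-]; rewrite pastsup_ge// ltW.
Qed.

(** * Half turn: exchanging past with future and suprema with infima *)

Definition half_turn S : R -> R := fun x => - S (- x).

Lemma half_turnK S : half_turn (half_turn S) = S.
Proof. by apply/funext => x; rewrite /half_turn !opprK. Qed.

Lemma Sc0_half_turn S : Sc0 S -> Sc0 (half_turn S).
Proof.
move=> [S00 Sc]; split; first by rewrite /half_turn oppr0 S00 oppr0.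
move=> x; apply: cvgN; apply: continuous_comp; last exact: Sc.
exact: oppr_continuous.
Qed.

Lemma futureinf_half_turn S x :
  futureinf S x = (- pastsup (half_turn S) (- x))%E.
Proof.
apply/eqP; rewrite eq_le; apply/andP; split.
  rewrite leeNr; apply: pastsup_le => y yx.
  by rewrite leeNr -EFinN opprK futureinf_le// lerNr.
apply: futureinf_ge => y xy; rewrite leeNl -EFinN -[y]opprK.
by apply: pastsup_ge; rewrite lerN2.
Qed.

Lemma PTinv_half_turn S : PTinv S = half_turn (PT (half_turn S)).
Proof.
apply/funext => x; rewrite /PTinv !futureinf_half_turn !fineN oppr0.
rewrite [RHS]/half_turn /PT (_ : half_turn S (- x) = - S x); first lra.
by rewrite /half_turn opprK.
Qed.

Lemma PT_half_turn S : PT S = half_turn (PTinv (half_turn S)).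
Proof. by rewrite PTinv_half_turn !half_turnK. Qed.

(** Negation is an involution, so V and its preimage under negation index the same family of
    suprema. *)
Lemma limf_esup_comp_opp (f : R -> \bar R) (F : set_system R) :
  limf_esup f (- x @[x --> F]) = limf_esup (fun x => f (- x)) F.
Proof.
congr ereal_inf; apply/seteqP; split=> [_ [V FV <-]|_ [V FV <-]].
  exists (-%R @^-1` V) => //; congr ereal_sup; apply/seteqP; split.
    by move=> _ [x Vx <-]; exists (- x).
  by move=> _ [x Vx <-]; exists (- x); rewrite /= ?opprK.
exists (-%R @^-1` V).
  rewrite /= /fmap/= (_ : _ @^-1` _ = V)//.
  by apply/seteqP; split => x /=; rewrite opprK.
congr ereal_sup; apply/seteqP; split.
  by move=> _ [x Vx <-]; exists (- x); rewrite /= ?opprK.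
by move=> _ [x Vx <-]; exists (- x); rewrite /= ?opprK.
Qed.

Lemma liminf_Noo_half_turn S : liminf_Noo S = (- limsup_oo (half_turn S))%E.
Proof. by rewrite /liminf_Noo /limf_einf -ninfty limf_esup_comp_opp. Qed.

Lemma liminf_oo_half_turn S : liminf_oo S = (- limsup_Noo (half_turn S))%E.
Proof. by rewrite /liminf_oo /limf_einf -ninftyN limf_esup_comp_opp. Qed.

Lemma PTinv_defined_half_turn S : PTinv_defined S = PT_defined (half_turn S).
Proof. by rewrite /PTinv_defined liminf_oo_half_turn lteNr. Qed.

Lemma ereal_inf_range_half_turn S :
  ereal_inf (range (EFin \o S)) = (- ereal_sup (range (EFin \o half_turn S)))%E.
Proof.
rewrite ereal_infEN; congr (- ereal_sup _)%E; apply/seteqP; split.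
  by move=> _ [_ [x _ <-] <-]; exists (- x); rewrite //= /half_turn opprK.
by move=> _ [x _ <-]; exists (S (- x))%:E => //; exists (- x).
Qed.

Lemma futureinf_cvg S :
  futureinf S x @[x --> -oo] --> ereal_inf (range (EFin \o S)).
Proof.
(* Reflecting the variable turns the limit at -oo into one at +oo, where the function is minus the
   past supremum of the half turn. *)
apply/cvgNy_compNP; rewrite ereal_inf_range_half_turn.
rewrite (_ : _ \o _ = \- pastsup (half_turn S))%E.
  exact/cvgeN/pastsup_cvg.
by apply/funext => x /=; rewrite futureinf_half_turn opprK.
Qed.

Lemma futureinf_NooE S : futureinf_Noo S = ereal_inf (range (EFin \o S)).
Proof. by apply/cvg_lim => //; exact: futureinf_cvg. Qed.

End PitmanTransformTheory.

Theorem theorem5p4 (R : realType) :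
  (forall S : R -> R, Sc0 S ->
    [/\ cvg (pastsup S x @[x --> +oo]),
        pastsup_oo S = ereal_sup (range (EFin \o S)),
        cvg (futureinf S x @[x --> -oo]) &
        futureinf_Noo S = ereal_inf (range (EFin \o S))]) /\
  @Screv R =
    [set S | Sc0 S /\
      [/\ (pastsup S 0 < +oo)%E, (-oo < futureinf S 0)%E,
          limsup_oo S = pastsup_oo S &
          liminf_Noo S = futureinf_Noo S]].
Proof.
split=> [S _|].
  split; first by apply/cvg_ex; eexists; exact: pastsup_cvg.
  - exact: pastsup_ooE.
  - by apply/cvg_ex; eexists; exact: futureinf_cvg.
  - exact: futureinf_NooE.
apply/funext => S; apply/propext.
suff H (S0 : Sc0 S) :
  ([/\ PT_defined S, PTinv_defined S, PTinv_defined (PT S) &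
       PT_defined (PTinv S)] /\ PTinv (PT S) = S /\ PT (PTinv S) = S) <->
  [/\ (pastsup S 0 < +oo)%E, (-oo < futureinf S 0)%E,
      limsup_oo S = pastsup_oo S & liminf_Noo S = futureinf_Noo S].
  by split=> -[S0 /(H S0)].
have Sc := S0.2; have rSc := (Sc0_half_turn S0).2.
have futE : (-oo < futureinf S 0)%E = (pastsup (half_turn S) 0 < +oo)%E.
  by rewrite futureinf_half_turn oppr0 lteNr.
have limE : liminf_Noo S = futureinf_Noo S <->
    limsup_oo (half_turn S) = pastsup_oo (half_turn S).
  rewrite liminf_Noo_half_turn futureinf_NooE.
  rewrite ereal_inf_range_half_turn pastsup_ooE.
  by split=> [/oppe_inj|->].
(* Conjugation turns T T^-1 S into the half turn of T^-1 T applied to [half_turn S]; a half turn of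
   both sides finishes. *)
have invE : PT (PTinv S) = S <-> PTinv (PT (half_turn S)) = half_turn S.
  rewrite PTinv_half_turn PT_half_turn half_turnK.
  by split=> [/(congr1 half_turn)|->]; rewrite half_turnK.
rewrite futE; split.
  move=> [[/(PT_definedE Sc) My]].
  rewrite PTinv_defined_half_turn => /(PT_definedE rSc) rMy _ _ [K].
  move=> /invE/(PTK_recurrent rSc rMy)/(limsup_oo_recurrent rSc rMy) rlim.
  split=> //; last exact/limE.
  exact/(limsup_oo_recurrent Sc My)/(PTK_recurrent Sc My).
move=> [My rMy lim /limE rlim]; split; last first.
  split; first exact/(PTK_recurrent Sc My)/(limsup_oo_recurrent Sc My).
  exact/invE/(PTK_recurrent rSc rMy)/(limsup_oo_recurrent rSc rMy).
split; first exact/PT_definedE.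
- by rewrite PTinv_defined_half_turn; exact/PT_definedE.
- exact: PTinv_defined_PT.
(* The bound for T of [half_turn S], carried back: a lower bound at +oo becomes an upper bound for
   T^-1 S at -oo. *)
- have := PTinv_defined_PT rSc rMy.
  by rewrite PTinv_defined_half_turn PTinv_half_turn.
Qed.
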